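(* The class of ideals which have topological representations is invariant under the Rudin--Blass equivalence: if $J$ and $K$ are ideals on $\omega$ such that $J\leq_{\mathrm{RB}}K$ and $K\leq_{\mathrm{RB}}J$, and $J$ has a topological representation, then $K$ has a topological representation.
   Context: An ideal on a set $E$ is a family of subsets of $E$ closed under taking subsets and finite unions; it is always assumed to contain all singletons $\{s\}$, $s\in E$. For ideals $J,K$ on $\omega$, write $J\leq_{\mathrm{RB}}K$ ($J$ is Rudin--Blass below $K$) if there is a finite-to-one function $f:\omega\to\omega$ such that for every $a\subseteq\omega$: $a\in J$ if and only if $f^{-1}(a)\in K$. The ideals $J$ and $K$ are Rudin--Blass equivalent if $J\leq_{\mathrm{RB}}K$ and $K\leq_{\mathrm{RB}}J$. A $\sigma$-ideal on a set $X$ is a family of subsets of $X$ closed under taking subsets and countable unions, assumed to contain all singletons of $X$. Given a separable metrizable space $X$, a $\sigma$-ideal $I$ on $X$ and a countable dense set $D\subseteq X$, let $J_I=\{a\subseteq D:\mathrm{cl}(a)\in I\}$, where $\mathrm{cl}$ is closure in $X$. An ideal $J$ on a countable set $E$ has a topological representation if there are such $X$, $I$, $D$ and a bijection $\rho:E\to D$ with $J=\{a\subseteq E:\rho(a)\in J_I\}$, where $\rho(a)$ is the image of $a$. *)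

(* Defs.v *)
From mathcomp Require Import all_boot all_order all_algebra.
From mathcomp Require Import all_classical all_reals all_analysis.

Set Implicit Arguments.
Unset Strict Implicit.
Unset Printing Implicit Defensive.

Local Open Scope classical_set_scope.
Local Open Scope ring_scope.

(* Ideals need not be proper; [ideal0] and [sideal0] are the empty unions. *)
Record is_ideal (E : Type) (J : set_system E) : Prop := IsIdeal {
  ideal0 : J set0 ;
  ideal_subset : forall a b, a `<=` b -> J b -> J a ;
  ideal_setU : forall a b, J a -> J b -> J (a `|` b) ;
  ideal_set1 : forall s, J [set s]
}.

Record is_sigma_ideal (X : Type) (I : set_system X) : Prop := IsSigmaIdeal {
  sideal0 : I set0 ;
  sideal_subset : forall a b, a `<=` b -> I b -> I a ;
  sideal_bigcup : forall F : nat -> set X, (forall n, I (F n)) ->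
    I (\bigcup_n F n) ;
  sideal_set1 : forall x, I [set x]
}.

Definition finite_to_one (A B : Type) (f : A -> B) : Prop :=
  forall b, finite_set (f @^-1` [set b]).

Definition RB_below (J K : set_system nat) : Prop :=
  exists f : nat -> nat,
    finite_to_one f /\ forall a : set nat, J a <-> K (f @^-1` a).

Definition RB_equiv (J K : set_system nat) : Prop :=
  RB_below J K /\ RB_below K J.

Record is_metric (R : realType) (X : Type) (d : X -> X -> R) : Prop :=
  IsMetric {
  metric_refl : forall x, d x x = 0 ;
  metric_separated : forall x y, d x y = 0 -> x = y ;
  metric_symmetric : forall x y, d x y = d y x ;
  metric_triangular : forall x y z, d x z <= d x y + d y z
}.

Definition metrizable (R : realType) (X : topologicalType) : Prop :=
  exists2 d : X -> X -> R, is_metric d &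
    forall x : X,
      nbhs x = filter_from [set e : R | 0 < e] (fun e => [set y | d x y < e]).

Definition separable (X : topologicalType) : Prop :=
  exists2 A : set X, countable A & dense A.

Definition closure_ideal (X : topologicalType) (I : set_system X)
    (D : set X) : set_system X :=
  [set a | a `<=` D /\ I (closure a)].

Definition has_topological_representation (R : realType) (E : Type)
    (J : set_system E) : Prop :=
  exists (X : topologicalType) (I : set_system X) (D : set X) (rho : E -> X),
    [/\ separable X /\ metrizable R X,
        is_sigma_ideal I,
        countable D /\ dense D,
        set_bij [set: E] D rho &
        J = [set a | closure_ideal I D (rho @` a)]].

(* Main.v *)
(* An ideal on a countable set has a topological representation exactly when it
   is tall (every infinite set contains an infinite set of the ideal) and
   countably separated; the former passes upwards, the latter downwards along
   Rudin-Blass reductions.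
   Given a representation, an infinite subset of [D] contains a convergent
   sequence or is closed, hence contains an infinite set with countable closure;
   and the traces on [D] of a countable base separate, because
   [cl b `\` cl a] is covered by countably many basic sets missing [a].
   Conversely, a separating family [c] sends [n] to the point [(n \in c j)_j] of
   the Cantor space; [X] is the closure of these points, and the sigma-ideal is
   generated by the sets [A] such that every non-small [b] stays non-small on
   some basic clopen set disjoint from [A]. *)
Require Import Defs.
From HB Require Import structures.
From mathcomp Require Import all_boot all_order all_algebra.
From mathcomp Require Import all_classical all_reals all_analysis.
From mathcomp Require Import lra.

Set Implicit Arguments.
Unset Strict Implicit.
Unset Printing Implicit Defensive.

Import Order.TTheory GRing.Theory Num.Theory.

Local Open Scope classical_set_scope.

(** * Tallness and countable separation, and their transfer along reductions *)

Definition tall (J : set_system nat) : Prop :=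
  forall a, infinite_set a -> exists2 a', infinite_set a' & a' `<=` a /\ J a'.

Definition countably_separated (J : set_system nat) : Prop :=
  exists c : nat -> set nat, forall a b, J a -> ~ J b ->
    exists n, a `&` c n = set0 /\ ~ J (b `&` c n).

Lemma infinite_nat_unbounded (a : set nat) :
  infinite_set a <-> forall N, exists2 n, a n & (N <= n)%N.
Proof.
split=> [inf_a N | unb /finite_seqP[s as_]].
  apply: contrapT => nex; apply: inf_a.
  apply: (sub_finite_set _ (finite_II N)) => n an /=.
  by rewrite ltnNge; apply/negP => Nn; apply: nex; exists n.
have [n an] := unb (\max_(i <- s) i).+1.
apply/negP; rewrite -leqNgt; apply: leq_bigmax_seq => //.
by move: an; rewrite as_.
Qed.

Lemma ideal_finite (J : set_system nat) (a : set nat) :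
  is_ideal J -> finite_set a -> J a.
Proof.
move=> JI /finite_seqP[s ->]; elim: s => [|x s IH].
  by apply: (ideal_subset JI) (ideal0 JI) => x.
apply: (ideal_subset JI) (ideal_setU JI (ideal_set1 JI x) IH) => y /=.
by rewrite inE => /orP[/eqP|]; [left|right].
Qed.

(** Since [f] is finite-to-one, the image of [a] is infinite. A small infinite part of that image
    pulls back to a part of [a] on which [f] is unbounded, hence to an infinite one. *)
Lemma tall_RB (J K : set_system nat) :
  is_ideal K -> RB_below J K -> tall J -> tall K.
Proof.
move=> KI [f [ff JK]] tJ a inf_a.
have inf_fa : infinite_set (f @` a).
  move=> fin; apply: inf_a.
  have : finite_set (\bigcup_(i in f @` a) f @^-1` [set i]).
    by apply: bigcup_finite => // i _; exact: ff.
  by apply: sub_finite_set => n an; exists (f n) => //; exists n.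
have [a' /infinite_nat_unbounded inf_a' [a'fa Ja']] := tJ _ inf_fa.
exists (a `&` f @^-1` a'); last first.
  split; first by move=> x [].
  by apply: (ideal_subset KI) (proj1 (JK a') Ja') => x [].
move=> /finite_seqP[s as_].
have [m a'm lt_m] := inf_a' (\max_(i <- s) f i).+1.
have [n an fn] := a'fa _ a'm.
have ns : n \in s.
  have : (a `&` f @^-1` a') n by split=> //=; rewrite /preimage /= fn.
  by rewrite as_.
have := @leq_bigmax_seq _ s predT f n ns isT.
by rewrite leqNgt fn lt_m.
Qed.

(** The images of the separating sets under [g] work: if the preimage of [a] misses [c n], then [a]
    misses the image of [c n]. *)
Lemma countably_separated_RB (J K : set_system nat) :
  is_ideal J -> RB_below K J -> countably_separated J -> countably_separated K.
Proof.
move=> JI [g [_ KJ]] [c cJ]; exists (fun n => g @` c n) => a b Ka nKb.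
have [n [ac bc]] : exists n, (g @^-1` a) `&` c n = set0 /\
    ~ J ((g @^-1` b) `&` c n).
  by apply: cJ; [exact/KJ|move=> /KJ].
exists n; split.
  rewrite -subset0 => y [ay [x cx xy]].
  by have : ((g @^-1` a) `&` c n) x; [split=> //=; rewrite /preimage /= xy | rewrite ac].
move=> /KJ Jbc; apply: bc; apply: (ideal_subset JI) Jbc => x [bx cx].
by split=> //; exists x.
Qed.

(** * Sigma-ideals and small closures in a metric space *)

Lemma sigma_ideal_setU (X : Type) (I : set_system X) (A B : set X) :
  is_sigma_ideal I -> I A -> I B -> I (A `|` B).
Proof.
move=> II IA IB; rewrite -bigcup2E; apply: (sideal_bigcup II) => -[|[|n]] //=.
exact: (sideal0 II).
Qed.

Lemma sigma_ideal_image_nat (X : Type) (I : set_system X) (s : nat -> X)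
  (P : set nat) : is_sigma_ideal I -> I (s @` P).
Proof.
move=> II; have := sideal_bigcup II (fun n => sideal_set1 II (s n)).
by apply: (sideal_subset II) => _ [n Pn <-]; exists n.
Qed.

Section metric.
Context (R : realType) (X : topologicalType) (d : X -> X -> R).
Hypothesis dM : is_metric d.
Hypothesis nbhs_d : forall x : X,
  nbhs x = filter_from [set e : R | (0 < e)%R] (fun e => [set y | (d x y < e)%R]).

Local Open Scope ring_scope.

Lemma metric_ge0 x y : 0 <= d x y.
Proof.
have := metric_triangular dM x y x.
by rewrite (metric_refl dM) (metric_symmetric dM y x) -mulr2n pmulrn_lge0.
Qed.

Lemma metric_gt0 x y : x <> y -> 0 < d x y.
Proof.
move=> xy; rewrite lt_neqAle metric_ge0 andbT eq_sym.
by apply/eqP => /(metric_separated dM).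
Qed.

Lemma closure_metricP (A : set X) x :
  closure A x <-> forall e : R, 0 < e -> exists2 y, A y & d x y < e.
Proof.
split=> [clA e e0|clA B].
  have [|y [Ay yB]] := clA [set y | d x y < e]; last by exists y.
  by rewrite nbhs_d; exists e.
rewrite nbhs_d => -[e e0 eB]; have [y Ay dy] := clA _ e0.
by exists y; split=> //; exact: eB.
Qed.

Lemma not_closure_metricP (A : set X) x :
  ~ closure A x <-> exists2 e : R, 0 < e & forall y, A y -> e <= d x y.
Proof.
split=> [ncl|[e e0 eA] /closure_metricP/(_ _ e0)[y Ay]]; last first.
  by rewrite ltNge eA.
apply: contrapT => nex; apply: ncl; apply/closure_metricP => e e0.
apply: contrapT => nexy; apply: nex; exists e => // y Ay.
by rewrite leNgt; apply/negP => dy; apply: nexy; exists y.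
Qed.

Lemma dense_metricP (D : set X) x e : dense D -> 0 < e ->
  exists2 y, D y & d x y < e.
Proof.
move=> denseD; suff /closure_metricP : closure D x by apply.
move=> B xB; have [|y [By Dy]] := denseD (interior B) _ (open_interior B).
  by exists x.
by exists y; split=> //; exact: interior_subset By.
Qed.

(** Finitely many terms different from [y] stay at a positive distance from it, so only a tail
    matters; the induction on [N] lowers [e] one term at a time. *)
Lemma closure_image_away (s : nat -> X) (P : set nat) y N e :
  0 < e -> (forall n, P n -> (N <= n)%N -> e <= d y (s n)) ->
  closure (s @` P) y -> (s @` P) y.
Proof.
move=> e0 far cly; apply: contrapT => nPy.
suff : exists2 e : R, 0 < e & forall z, (s @` P) z -> e <= d y z.
  by move/not_closure_metricP.
elim: N e e0 far => [|N IH] e e0 far.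
  by exists e => // _ [n Pn <-]; exact: far.
have [PN|nPN] := pselect (P N); last first.
  apply: (IH e e0) => n Pn; rewrite leq_eqVlt => /orP[/eqP Nn|]; last exact: far.
  by rewrite Nn in nPN.
apply: (IH (Num.min e (d y (s N)))).
  by rewrite lt_min e0 metric_gt0// => yN; apply: nPy; exists N.
move=> n Pn; rewrite leq_eqVlt ge_min => /orP[/eqP <-|lt_Nn].
  by rewrite lexx orbT.
by rewrite far.
Qed.

Lemma invS_lt (e : R) : 0 < e -> exists m, m.+1%:R^-1 < e.
Proof.
move=> e0; exists (Num.bound e^-1); rewrite invf_plt ?posrE//.
rewrite (lt_trans (archi_boundP _))// ?invr_ge0 ?ltW//.
by rewrite ltr_nat.
Qed.

Context (I : set_system X) (D : set X) (rho : nat -> X).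
Hypothesis II : is_sigma_ideal I.
Hypothesis dD : dense D.
Hypothesis rhoD : set_bij setT D rho.

Let J : set_system nat := [set a | closure_ideal I D (rho @` a)].

Let JE a : J a <-> I (closure (rho @` a)).
Proof.
split=> [[]//|Ia]; split=> // _ [n _ <-].
by case: rhoD => mapD _ _; exact: mapD.
Qed.

Lemma closure_ideal_tall : tall J.
Proof.
move=> a inf_a; have /infinite_nat_unbounded a_unb := inf_a.
have [[x acc]|nacc] := pselect (exists x, forall k N : nat,
    exists n, [/\ a n, (N <= n)%N & d x (rho n) < k.+1%:R^-1]).
(* Taking both parameters equal to [k] gives indices tending to infinity whose points converge to
   [x], so that the closure adds at most [x]. *)
- have /choice[q qP] := fun k => acc k k.
  exists (range q).
    apply/infinite_nat_unbounded => N; exists (q N); first by exists N.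
    by case: (qP N).
  split; first by move=> _ [k _ <-]; case: (qP k).
  apply/JE; apply: (sideal_subset II) (sigma_ideal_setU II
    (sideal_set1 II x) (sigma_ideal_image_nat (rho \o q) setT II)).
  rewrite image_comp => y cly; have [->|/eqP yx] := eqVneq y x; first by left.
  (* Points closer to [x] than half of [d y x] are farther than that half from [y]. *)
  right; have d0 : 0 < d y x / 2 by rewrite divr_gt0// metric_gt0.
  have [N ltN] := invS_lt d0.
  move: cly; apply: (closure_image_away (N := N) d0) => k _ Nk /=.
  have [_ _ dk] := qP k.
  have dkN : d (rho (q k)) x < d y x / 2.
    rewrite (metric_symmetric dM) (lt_le_trans dk)// (le_trans _ (ltW ltN))//.
    by rewrite lef_pV2 ?posrE// ler_nat.
  have := metric_triangular dM y (rho (q k)) x.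
  by lra.
- exists a => //; split=> //; apply/JE.
  apply: (sideal_subset II) (sigma_ideal_image_nat rho a II) => y.
  have [k [N far]] : exists k N : nat,
      forall n, a n -> (N <= n)%N -> k.+1%:R^-1 <= d y (rho n).
    apply: contrapT => nfar; apply: nacc; exists y => k N.
    apply: contrapT => nex; apply: nfar; exists k, N => n an Nn.
    by rewrite leNgt; apply/negP => dn; apply: nex; exists n.
  by apply: (closure_image_away (N := N) _ far); rewrite invr_gt0.
Qed.

Lemma closure_ideal_countably_separated : countably_separated J.
Proof.
(* The traces of the balls of radius [m.+1%:R^-1] about the points of [D]. *)
pose c k := if unpickle k is Some (i, m)
  then [set n | d (rho i) (rho n) < m.+1%:R^-1] else set0.
exists c => a b /JE Ia nJb; apply: contrapT => nsep; apply: nJb; apply/JE.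
(* If no [c k] separates, every [F k] is small, and these sets together with the closure of [a]
   cover the closure of [b]. *)
pose F k := if `[< a `&` c k = set0 >] then closure (rho @` (b `&` c k)) else set0.
have IF k : I (F k).
  rewrite /F; case: asboolP => [ack|_]; last exact: (sideal0 II).
  by apply: contrapT => nI; apply: nsep; exists k; split=> // /JE.
apply: (sideal_subset II) (sigma_ideal_setU II Ia (sideal_bigcup II IF)).
move=> y cly; have [|/not_closure_metricP[e e0 far]] := pselect (closure (rho @` a) y).
  by left.
(* A ball of this radius whose centre is within the same radius of [y] stays within [e] of [y],
   hence misses [a]. *)
right; have [m ltm] : exists m, m.+1%:R^-1 < e / 2.
  by apply: invS_lt; rewrite divr_gt0.
have [z Dz dz] : exists2 z, D z & d y z < m.+1%:R^-1.
  by apply: dense_metricP => //; rewrite invr_gt0.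
have [i _ iz] : (rho @` setT) z by case: rhoD => _ _; apply.
rewrite -{z Dz}iz in dz.
have cE : c (pickle (i, m)) = [set n | d (rho i) (rho n) < m.+1%:R^-1].
  by rewrite /c pickleK.
exists (pickle (i, m)) => //; rewrite /F; case: asboolP => [_|[]]; last first.
  rewrite cE -subset0 => n [an /= dn].
  have := far (rho n) (ex_intro2 _ _ n an erefl).
  have := metric_triangular dM y (rho i) (rho n).
  by move: (m.+1%:R^-1) ltm dz dn => r *; lra.
rewrite cE; apply/closure_metricP => e' e'0.
(* The second term keeps points this close to [y] inside the ball about [rho i]. *)
have e''0 : 0 < Num.min e' (m.+1%:R^-1 - d y (rho i)).
  by rewrite lt_min e'0 subr_gt0.
have [_ [n bn <-]] := proj1 (closure_metricP _ _) cly _ e''0.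
rewrite lt_min => /andP[dn dn']; exists (rho n) => //; exists n => //; split=> //=.
have := metric_triangular dM (rho i) y (rho n).
by rewrite (metric_symmetric dM (rho i) y); move: (m.+1%:R^-1) dn' => r *; lra.
Qed.
End metric.

(** * The space of branches, its topology and its metric *)

Definition agree (k : nat) (x y : nat -> bool) : Prop :=
  forall j, (j < k)%N -> x j = y j.

Lemma agree_sym k x y : agree k x y -> agree k y x.
Proof. by move=> xy j jk; rewrite xy. Qed.

Lemma agree_trans k x y z : agree k x y -> agree k y z -> agree k x z.
Proof. by move=> xy yz j jk; rewrite xy // yz. Qed.

Lemma agree_le k l x y : (k <= l)%N -> agree l x y -> agree k x y.
Proof. by move=> kl xy j jk; rewrite xy // (leq_trans jk). Qed.

(** The closure of the range of [e] in the Cantor space, as a type. *)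
Definition branch (e : nat -> nat -> bool) : Type :=
  {x : nat -> bool | forall k, exists n, agree k x (e n)}.

Section branch_topology.
Context (e : nat -> nat -> bool).
Local Notation X := (branch e).
Implicit Types (x y : X) (A : set X).

Definition cylinder k x : set X := [set y | agree k (sval x) (sval y)].

Definition branch_nbhs x : set_system X := filter_from setT (cylinder ^~ x).

HB.instance Definition _ := gen_eqMixin X.
HB.instance Definition _ := gen_choiceMixin X.
HB.instance Definition _ := hasNbhs.Build X branch_nbhs.

Let branch_nbhs_filter x : ProperFilter (nbhs x).
Proof.
apply: filter_from_proper => [|k _]; last by exists x.
apply: filter_from_filter; first by exists 0%N.
move=> k l _ _; exists (maxn k l) => // y xy; split.
  by apply: agree_le xy; exact: leq_maxl.
by apply: agree_le xy; exact: leq_maxr.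
Qed.

Let branch_nbhs_singleton x A : nbhs x A -> A x.
Proof. by move=> [k _]; apply. Qed.

Let branch_nbhs_nbhs x A : nbhs x A -> nbhs x (nbhs^~ A).
Proof.
move=> [k _ kA]; exists k => // y xy; exists k => // z yz.
by apply: kA; exact: agree_trans yz.
Qed.

HB.instance Definition _ := Nbhs_isNbhsTopological.Build X
  branch_nbhs_filter branch_nbhs_singleton branch_nbhs_nbhs.

Lemma closure_branchP A x :
  closure A x <-> forall k, exists2 y, A y & agree k (sval x) (sval y).
Proof.
split=> [clA k|clA B [k _ kB]].
  have [|y [Ay yB]] := clA (cylinder k x); last by exists y.
  by exists k.
by have [y Ay xy] := clA k; exists y; split => //; exact: kB.
Qed.

Definition node (n : nat) : X :=
  exist _ (e n) (fun k => ex_intro _ n (fun j _ => erefl)).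

Lemma dense_node : dense (range node).
Proof.
move=> O [x Ox] Oopen; have [k _ kO] := open_nbhs_nbhs (conj Oopen Ox).
have [n xn] := svalP x k.
by exists (node n); split; [exact: kO|exists n].
Qed.

End branch_topology.

Section branch_metric.
Context (R : realType) (e : nat -> nat -> bool).
Local Notation X := (branch e).
Implicit Types x y z : X.
Local Open Scope ring_scope.

Definition branch_dist x y : R :=
  if pselect (exists j, sval x j != sval y j) is left ex
  then (ex_minn ex).+1%:R^-1 else 0.

Lemma branch_dist_lt x y k :
  branch_dist x y < k.+1%:R^-1 <-> agree k.+1 (sval x) (sval y).
Proof.
rewrite /branch_dist; case: pselect => [ex|nex]; last first.
  split=> [_ j _|_]; last by rewrite invr_gt0.
  by apply/eqP/negPn/negP => xyj; apply: nex; exists j.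
case: ex_minnP => m xym minm; rewrite ltf_pV2 ?posrE// ltr_nat ltnS.
split=> [km j jk|xy].
  apply/eqP/negPn/negP => /minm mj.
  by have := leq_ltn_trans mj jk; rewrite ltnS leqNgt km.
by rewrite ltnNge; apply/negP => mk; move: xym; rewrite xy ?eqxx.
Qed.

Lemma branch_dist_diff x y j : sval x j != sval y j -> j.+1%:R^-1 <= branch_dist x y.
Proof.
move=> xyj; rewrite leNgt; apply/negP => /branch_dist_lt xy.
by rewrite xy ?eqxx in xyj.
Qed.

Lemma branch_dist_cases x y : branch_dist x y = 0 \/
  exists2 j, sval x j != sval y j & branch_dist x y = j.+1%:R^-1.
Proof.
rewrite /branch_dist; case: pselect => [ex|_]; last by left.
by case: ex_minnP => m xym _; right; exists m.
Qed.

Lemma branch_dist_ge0 x y : 0 <= branch_dist x y.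
Proof. by case: (branch_dist_cases x y) => [|[j _]] -> //; rewrite invr_ge0. Qed.

Lemma branch_dist_metric : is_metric branch_dist.
Proof.
(* The ultrametric inequality: at the first coordinate where [x] and [y] differ, [z] differs from
   one of them. *)
have dist_le x y z : branch_dist x y = 0 \/
    branch_dist x y <= branch_dist x z \/ branch_dist x y <= branch_dist z y.
  have [|[j xyj ->]] := branch_dist_cases x y; [by left | right].
  have [xzj|xzj] := eqVneq (sval x j) (sval z j).
    by right; apply: branch_dist_diff; rewrite -xzj.
  by left; exact: branch_dist_diff.
have distxx x : branch_dist x x = 0.
  by have [|[j]] := branch_dist_cases x x; rewrite ?eqxx.
split=> //.
- move=> [x px] [y py] xy0; apply: eq_exist; apply/funext => j; apply/eqP/negPn/negP.
  move=> xyj; have := @branch_dist_diff (exist _ x px) (exist _ y py) j xyj.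
  by rewrite xy0 leNgt invr_gt0 ltr0n.
- suff sym x y : branch_dist x y <= branch_dist y x.
    by move=> x y; apply/le_anti; rewrite !sym.
  have [->|[j xyj ->]] := branch_dist_cases x y; first exact: branch_dist_ge0.
  by apply: branch_dist_diff; rewrite eq_sym.
move=> x y z; have [->|[le|le]] := dist_le x z y.
- by rewrite addr_ge0 ?branch_dist_ge0.
- by rewrite (le_trans le)// lerDl branch_dist_ge0.
- by rewrite (le_trans le)// lerDr branch_dist_ge0.
Qed.

Lemma branch_metrizable : metrizable R X.
Proof.
exists branch_dist; first exact: branch_dist_metric.
move=> x; apply/seteqP; split=> [A [k _ kA]|A [r /= r0 rA]].
  exists k.+1%:R^-1; first by rewrite /= invr_gt0.
  by move=> y /branch_dist_lt xy; apply: kA; exact: agree_le xy.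
have [k kr] := invS_lt r0.
by exists k.+1 => // y xy; apply: rA; apply: lt_trans kr; exact/branch_dist_lt.
Qed.

End branch_metric.

(** * The sigma-ideal generated by the avoidable sets *)

Section avoidable.
Context (K : set_system nat) (e : nat -> nat -> bool).
Hypothesis KI : is_ideal K.
Local Notation X := (branch e).
Implicit Types (a b : set nat) (p k : nat) (A : set X).

Definition trace k (x : X) : set nat := node e @^-1` cylinder k x.

(** An analogue of being nowhere dense, with positive sets of indices (those outside [K]) in place
    of nonempty open sets. *)
Definition avoidable A : Prop := forall b, ~ K b ->
  exists p k, A `&` cylinder k (node e p) = set0 /\
    ~ K (b `&` trace k (node e p)).

(** When a positive set is split by one more coordinate, one half is positive because [K] is closed
    under unions; any member of that half can serve as the new centre. *)
Lemma positive_trace b k : ~ K b ->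
  exists2 p, b p & ~ K (b `&` trace k (node e p)).
Proof.
move=> nKb.
have nonempty c : ~ K c -> exists p, c p.
  move=> nKc; apply: contrapT => nex; apply: nKc.
  by apply: (ideal_subset KI) (ideal0 KI) => p cp; apply: nex; exists p.
elim: k => [|k [p bp nKp]].
  have [p bp] := nonempty _ nKb; exists p => // Kb; apply: nKb.
  by apply: (ideal_subset KI) Kb => q bq; split.
pose bk v := b `&` trace k (node e p) `&` [set q | e q k = v].
have [v nKv] : exists v, ~ K (bk v).
  apply: contrapT => nex; apply: nKp.
  have Kbk v : K (bk v) by apply: contrapT => nKv; apply: nex; exists v.
  apply: (ideal_subset KI) (ideal_setU KI (Kbk true) (Kbk false)) => q bq.
  by case E: (e q k); [left|right].
have [q [[bq pq] qv]] := nonempty _ nKv.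
exists q => // Kq; apply: nKv; apply: (ideal_subset KI) Kq => r [[br pr] rv].
split=> // j; rewrite ltnS leq_eqVlt => /orP[/eqP ->|jk] /=.
  by rewrite qv rv.
exact: etrans (esym (pq j jk)) (pr j jk).
Qed.

Lemma avoidable0 : avoidable set0.
Proof.
move=> b /(positive_trace 0)[p _ nKp]; exists p, 0%N; split=> //.
by rewrite set0I.
Qed.

(* A fusion (Baire category) argument: shrink [b] to positive traces of longer
   and longer cylinders, the [i]-th one missing [F i]; the branch they determine
   is a limit of points of [b] outside all the [F i]. *)
Lemma closure_not_bigcup_avoidable b (F : nat -> set X) :
  ~ K b -> (forall i, avoidable (F i)) ->
  ~ closure (node e @` b) `<=` \bigcup_i F i.
Proof.
move=> nKb avF clF.
(* The argument holds a stage [i], a centre [p] and a length [k], the result the next centre and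
   length. Stating positivity as a premise makes the choice total. *)
have step (s : nat * (nat * nat)) : exists t : nat * nat,
    b s.2.1 /\ ~ K (b `&` trace s.2.2 (node e s.2.1)) ->
    [/\ (s.2.2 < t.2)%N, agree s.2.2 (e s.2.1) (e t.1),
        b t.1 /\ ~ K (b `&` trace t.2 (node e t.1)) &
        F s.1 `&` cylinder t.2 (node e t.1) = set0].
  case: s => i [p k] /=.
  have [pos|npos] := pselect (b p /\ ~ K (b `&` trace k (node e p))); last first.
    by exists (0, 0)%N.
  have [q [l [Fq]]] := avF i _ pos.2.
  (* Here [k.+1] makes the length grow strictly, and [l] keeps the new cylinder inside the one
     missing [F i]. *)
  move=> /(positive_trace (maxn k.+1 l))[r [[br pr] qr] nKr].
  exists (r, maxn k.+1 l) => _; split => //=.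
  - exact: leq_maxl.
  - split=> // Kr; apply: nKr; apply: (ideal_subset KI) Kr => s.
    by move=> [[[bs _] _] rs]; split.
  - rewrite -subset0 -Fq => y [Fy ry]; split=> //.
    by apply: agree_trans qr _; apply: agree_le ry; exact: leq_maxr.
have [g gP] := choice step.
have [p0 bp0 nKp0] := positive_trace 0 nKb.
pose fix u i := if i is j.+1 then g (j, u j) else (p0, 0%N).
have upos i : b (u i).1 /\ ~ K (b `&` trace (u i).2 (node e (u i).1)).
  by elim: i => [//|i IH] /=; case: (gP (i, u i) IH).
have uP i := gP (i, u i) (upos i).
have le_u i : (i <= (u i).2)%N.
  by elim: i => // i IH; case: (uP i) => + _ _ _; exact: leq_ltn_trans.
have agree_u i j : (i <= j)%N ->
    ((u i).2 <= (u j).2)%N /\ agree (u i).2 (e (u i).1) (e (u j).1).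
  elim: j => [|j IH]; first by rewrite leqn0 => /eqP ->.
  rewrite leq_eqVlt => /orP[/eqP ->//|/IH[le_ij ij]].
  have [lt_j jS _ _] := uP j; split; first exact: leq_trans le_ij (ltnW lt_j).
  by apply: agree_trans ij _; exact: agree_le jS.
(* Stage [j.+1] has length at least [j.+1], so it has settled coordinate [j]. *)
pose x j := e (u j.+1).1 j.
have ux i : agree (u i).2 (e (u i).1) x.
  move=> j ji; have [ij|ji'] := leqP i j.+1.
    by case: (agree_u _ _ ij) => _; apply.
  have [_ jSi] := agree_u _ _ (ltnW ji').
  by rewrite -(jSi j (le_u j.+1)).
have xu k : agree k x (e (u k).1).
  by apply: agree_sym; exact: agree_le (ux k).
pose y : X := exist _ x (fun k => ex_intro _ (u k).1 (xu k)).
have /clF[i _ Fy] : closure (node e @` b) y.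
  apply/closure_branchP => k; exists (node e (u k).1); last exact: xu.
  by exists (u k).1 => //; case: (upos k).
have [_ _ _ Fi] := uP i.
have : (F i `&` cylinder (u i.+1).2 (node e (u i.+1).1)) y.
  by split=> //; exact: ux.
by rewrite Fi.
Qed.

Hypothesis e_separates : forall a b, K a -> ~ K b ->
  exists k, (forall n, a n -> ~~ e n k) /\ ~ K (b `&` [set n | e n k]).

Lemma closure_avoidable a : K a -> avoidable (closure (node e @` a)).
Proof.
move=> Ka b nKb; have [k [ak nKk]] := e_separates Ka nKb.
(* Length [k.+1] makes the cylinder decide coordinate [k], which is true at [p] and false on [a]. *)
have [p [bp ep] nKp] := positive_trace k.+1 nKk; exists p, k.+1; split.
  rewrite -subset0 => y [/closure_branchP/(_ k.+1)[_ [n an <-] yn] py].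
  have enp : e n k = e p k := esym (agree_trans py yn (ltnSn k)).
  by have := ak n an; rewrite enp ep.
by move=> Kp; apply: nKp; apply: (ideal_subset KI) Kp => q [[bq _] pq].
Qed.

(** If [b] is a counterexample, every cylinder with a positive trace on [b] contains [x], so the
    traces around [x] are positive and nodes of [b] converge to [x]. Tallness thins them to a set
    [a] in [K] with [x] in its closure; avoiding that closure yields a positive trace away from
    [x]. *)
Lemma avoidable_set1 (x : X) : tall K -> avoidable [set x].
Proof.
move=> tallK b nKb; apply: contrapT => nav.
have on_x p k : ~ K (b `&` trace k (node e p)) -> agree k (e p) (sval x).
  move=> nKp; apply: contrapT => npx; apply: nav; exists p, k; split=> //.
  by rewrite -subset0 => _ [-> /npx].
have nKx k : ~ K (b `&` trace k x).
  move=> Kx; have [p _ nKp] := positive_trace k nKb; apply: (nKp).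
  apply: (ideal_subset KI) Kx => q [bq pq]; split=> //.
  by apply: agree_trans pq; apply: agree_sym; exact: on_x nKp.
have /choice[q qP] k : exists n, (b `&` trace k x) n /\ (k <= n)%N.
  have : infinite_set (b `&` trace k x) by move=> /(ideal_finite KI)/nKx.
  by move=> /infinite_nat_unbounded/(_ k)[n bn kn]; exists n.
have /tallK[a inf_a [aq Ka]] : infinite_set (range q).
  apply/infinite_nat_unbounded => N; exists (q N); first by exists N.
  by case: (qP N).
have clx : closure (node e @` a) x.
  (* If no node of [a] agreed with [x] up to [k], only the values of [q] below [k] could lie in
     [a]. *)
  apply/closure_branchP => k; apply: contrapT => nex; apply: inf_a.
  apply: (sub_finite_set _ (finite_image q (finite_II k))) => n an.
  have [j _ qj] := aq n an; exists j => //=; rewrite ltnNge; apply/negP => kj.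
  apply: nex; exists (node e n); first by exists n.
  by have [[_ xq] _] := qP j; rewrite -qj; exact: agree_le xq.
have [p [k [clp nKp]]] := closure_avoidable Ka nKb.
have : (closure (node e @` a) `&` cylinder k (node e p)) x.
  by split=> //; exact: on_x nKp.
by rewrite clp.
Qed.

Definition avoidable_ideal : set_system X := [set A |
  exists F : nat -> set X, (forall i, avoidable (F i)) /\ A `<=` \bigcup_i F i].

Lemma avoidable_sigma A : avoidable A -> avoidable_ideal A.
Proof. by move=> avA; exists (fun=> A); split=> // x Ax; exists 0%N. Qed.

Lemma avoidable_ideal_sigma : tall K -> is_sigma_ideal avoidable_ideal.
Proof.
move=> tallK; split.
- exact/avoidable_sigma/avoidable0.
- by move=> A B AB [F [avF BF]]; exists F; split=> //; exact: subset_trans BF.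
- move=> A /choice[F FP].
  exists (fun k => if unpickle k is Some (i, j) then F i j else set0); split.
    move=> k; case: (unpickle k) => [[i j]|]; last exact: avoidable0.
    by case: (FP i).
  move=> x [i _ Ax]; have [_ /(_ x Ax)[j _ Fx]] := FP i.
  by exists (pickle (i, j)) => //; rewrite pickleK.
- by move=> x; apply/avoidable_sigma/avoidable_set1.
Qed.

Lemma avoidable_representation (R : realType) :
  tall K -> injective e -> has_topological_representation R K.
Proof.
move=> tallK e_inj.
have countable_node : countable (range (node e)) by exact: card_image_le.
exists X, avoidable_ideal, (range (node e)), (node e); split.
- split; last exact: branch_metrizable.
  by exists (range (node e)); last exact: dense_node.
- exact: avoidable_ideal_sigma.
- by split=> //; exact: dense_node.
- by split=> // m n _ _ /(congr1 sval)/e_inj.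
apply/seteqP; split=> [a Ka|a [_ [F [avF clF]]]].
  by split; [move=> _ [n _ <-]; exists n|exact/avoidable_sigma/closure_avoidable].
by apply: contrapT => /closure_not_bigcup_avoidable/(_ avF).
Qed.

End avoidable.

(* Interleaving the singletons with the separating family makes the coordinates
   injective, so that distinct numbers become distinct points. *)
Lemma tall_countably_separated_representation (R : realType)
  (K : set_system nat) : is_ideal K -> tall K -> countably_separated K ->
  has_topological_representation R K.
Proof.
move=> KI tallK [c cP].
pose e n k := if odd k then n == k./2 else n \in c k./2.
apply: (@avoidable_representation K e) => // [a b Ka nKb|m n emn].
  have [i [aci nKi]] := cP a b Ka nKb; exists i.*2; split.
    move=> n an; rewrite /e odd_double doubleK; apply/negP; rewrite inE => cn.
    by have : (a `&` c i) n; [|rewrite aci].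
  move=> Ki; apply: nKi; apply: (ideal_subset KI) Ki => n [bn cn]; split=> //.
  by rewrite /= /e odd_double doubleK inE.
(* The odd coordinate [m.*2.+1] tests equality with [m]. *)
have := congr1 (@^~ m.*2.+1) emn; rewrite /e /= odd_double /= uphalf_double eqxx.
by move=> /esym/eqP.
Qed.

Theorem corollary1p2 (R : realType) (J K : set_system nat)
  (J_ideal : is_ideal J) (K_ideal : is_ideal K) (JK : RB_equiv J K) :
  has_topological_representation R J -> has_topological_representation R K.
Proof.
case: JK => leJK leKJ [X [I [D [rho [[_ [d dM nbhs_d]] II [_ dD] rhoD JE]]]]].
apply: tall_countably_separated_representation => //.
  apply: (tall_RB K_ideal leJK); rewrite JE.
  exact (closure_ideal_tall dM nbhs_d II rhoD).
apply: (countably_separated_RB J_ideal leKJ); rewrite JE.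
exact (closure_ideal_countably_separated dM nbhs_d II dD rhoD).
Qed.
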